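(* There exists an absolute constant $C>0$ such that, with probability larger than $1-C/p$, the weights $$d_k=\sqrt{4\log p}\left[\sqrt{\langle V_k,Y\rangle+\frac{5B^2\log p}{3}}+\sqrt{B^2\log p}\right]+\frac{2B\log p}{3},\qquad k\in\{0,\dots,p-1\},$$ satisfy $$\big|(\tilde A^\top(\tilde Y-\tilde Ax^* ))_k\big|\le d_k\qquad\text{for all }k\in\{0,\dots,p-1\}.$$
   Context: Random convolution model: $p,m$ are positive integers, vectors in $\mathbb{R}^p$ are indexed by $\{0,\dots,p-1\}$ and indices are understood modulo $p$. $U_1,\dots,U_m$ are i.i.d. uniform on $\{0,\dots,p-1\}$; for $k\in\mathbb{Z}$, $\mathbb{N}(k)=\mathrm{card}\{i:U_i\equiv k\bmod p\}$; $A\in\mathbb{R}^{p\times p}$ is given by $A_{\ell,k}=\mathbb{N}(\ell-k)$. The vector $x^*\in\mathbb{R}_+^p$ is $s$-sparse for some $1\le s<\min(m,p)$. Conditionally on $U_1,\dots,U_m$, the entries of $Y$ are independent with $Y_\ell\sim\mathrm{Poisson}((Ax^* )_\ell)$. With $\mathbf 1\in\mathbb{R}^p$ the all-ones vector and $\overline Y=\frac1m\|Y\|_1$, $$\tilde A=\frac1{\sqrt m}A-\frac{\sqrt m-1}{p}\mathbf 1\mathbf 1^\top,\qquad\tilde Y_k=\frac1{\sqrt m}Y_k-\frac{\sqrt m-1}{p}\overline Y .$$ Further, $$V_{k,\ell}=\left(\frac{\mathbb{N}(\ell-k)-\frac{m-1}{p}}{m}\right)^2,\quad V_k=(V_{k,\ell})_\ell,\quad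 \langle V_k,Y\rangle=\sum_\ell V_{k,\ell}Y_\ell,\qquad B=\max_{u\in\{0,\dots,p-1\}}\frac1m\left|\mathbb{N}(u)-\frac{m-1}{p}\right| .$$ *)

(* Defs.v *)
From HB Require Import structures.
From mathcomp Require Import all_boot all_order all_algebra.
From mathcomp Require Import all_classical all_reals all_analysis.

Set Implicit Arguments.
Unset Strict Implicit.
Unset Printing Implicit Defensive.

Import Order.TTheory GRing.Theory Num.Theory.

Local Open Scope classical_set_scope.
Local Open Scope ring_scope.

(* Vectors of R^p are column vectors indexed by 'I_p = {0, ..., p-1}; index
   differences are taken in int and read modulo p inside [Ncount]. *)

Section probability_notions.
Context d (T : measurableType d) (R : realType) (P : probability T R).

Definition pr (A : set T) : R := fine (P A).

(* meaningful when pr E != 0; equal to 0 otherwise *)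
Definition cond_pr (E A : set T) : R := pr (A `&` E) / pr E.

(* The set function mu stands for [pr] or [cond_pr E].  The product rule is
   required for every finite subfamily and all measurable sets. *)
Definition mutually_independent (mu : set T -> R)
    d' (T' : measurableType d') (I : finType) (X : I -> T -> T') : Prop :=
  forall (J : {set I}) (B : I -> set T'), (forall i, measurable (B i)) ->
    mu (\bigcap_(i in [set` J]) (X i @^-1` B i)) =
    \prod_(i in J) mu (X i @^-1` B i).

(* X is nat-valued, its law under mu is uniform on {0, ..., p-1} *)
Definition uniform_below (mu : set T -> R) (p : nat) (X : T -> nat) : Prop :=
  forall j : nat, mu (X @^-1` [set j]) = if (j < p)%N then p%:R^-1 else 0.

(* [poisson_prob] takes a natural number that it ignores, hence the 0%N;
   [poisson_prob 0 _] is the Dirac mass at 0. *)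
Definition poisson_law (mu : set T -> R) (rate : R) (X : T -> nat) : Prop :=
  forall B : set nat, mu (X @^-1` B) = fine (poisson_prob rate 0%N B).

End probability_notions.

(* Quantities attached to a fixed outcome u of (U_1, ..., U_m). *)
Section convolution.
Variables (R : realType) (p m : nat) (u : 'I_m -> nat).

(* N(k) = card {i : u_i = k mod p} for an integer k of any sign *)
Definition Ncount (k : int) : nat :=
  #|[pred i : 'I_m | ((u i)%:Z == k %[mod p%:Z])%Z]|.

Definition conv_mx : 'M[R]_p :=
  \matrix_(l < p, k < p) (Ncount (l%:Z - k%:Z))%:R.

Definition ones : 'cV[R]_p := const_mx 1.

Definition centering : R := (Num.sqrt m%:R - 1) / p%:R.

Definition conv_mx_tilde : 'M[R]_p :=
  (Num.sqrt m%:R)^-1 *: conv_mx - centering *: (ones *m ones^T).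

Definition ybar (y : 'cV[R]_p) : R := m%:R^-1 * \sum_(l < p) `|y l 0|.

Definition y_tilde (y : 'cV[R]_p) : 'cV[R]_p :=
  \col_(k < p) ((Num.sqrt m%:R)^-1 * y k 0 - centering * ybar y).

Definition V_mx : 'M[R]_p :=
  \matrix_(k < p, l < p)
    (((Ncount (l%:Z - k%:Z))%:R - (m%:R - 1) / p%:R) / m%:R) ^+ 2.

Definition V_dot (k : 'I_p) (y : 'cV[R]_p) : R :=
  \sum_(l < p) V_mx k l * y l 0.

(* the terms are nonnegative, so the default value 0 is harmless for p > 0 *)
Definition B_max : R :=
  \big[Num.max/0]_(v < p)
    (m%:R^-1 * `|(Ncount v%:Z)%:R - (m%:R - 1) / p%:R|).

Definition weight (y : 'cV[R]_p) (k : 'I_p) : R :=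
  let L : R := ln p%:R in
  Num.sqrt (4 * L) *
    (Num.sqrt (V_dot k y + 5 * B_max ^+ 2 * L / 3) + Num.sqrt (B_max ^+ 2 * L))
  + 2 * B_max * L / 3.

End convolution.

Definition sparse (R : realType) (p s : nat) (x : 'cV[R]_p) : Prop :=
  (#|[pred k : 'I_p | (x k 0 != 0)%R]| <= s)%N.

Section random_convolution_model.
Context d (T : measurableType d) (R : realType) (P : probability T R).
Variables (p m : nat).
Variables (U : 'I_m -> {RV P >-> nat}) (Y : 'I_p -> {RV P >-> nat}).

Definition iid_uniform : Prop :=
  mutually_independent (pr P) (fun i => U i : T -> nat) /\
  forall i, uniform_below (pr P) p (U i).

(* Since (U_1, ..., U_m) is discrete, conditioning on it is elementary
   conditioning on each outcome {U = u} of positive probability. *)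
Definition cond_poisson (x : 'cV[R]_p) : Prop :=
  forall u : 'I_m -> nat,
    let E := [set w : T | forall i, U i w = u i] in
    0 < pr P E ->
    mutually_independent (cond_pr P E) (fun l => Y l : T -> nat) /\
    forall l, poisson_law (cond_pr P E) ((conv_mx R p u *m x) l 0) (Y l).

Definition locations (w : T) : 'I_m -> nat := fun i => U i w.

Definition observations (w : T) : 'cV[R]_p := \col_(l < p) (Y l w)%:R.

End random_convolution_model.

(* Main.v *)
Require Import Defs.
From HB Require Import structures.
From mathcomp Require Import all_boot all_order all_algebra.
From mathcomp Require Import all_classical all_reals all_analysis.
From mathcomp Require Import ring lra.

Import Order.TTheory GRing.Theory Num.Theory.
Import numFieldNormedType.Exports.

Local Open Scope classical_set_scope.
Local Open Scope ring_scope.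

(** Write lambda = A x for the conditional mean of Y.  Every column of A sums
    to m, and the centering constants are tuned so that the k-th coordinate of
    the weighted residual collapses to sum_l r_kl (Y_l - lambda_l), where
    r_kl = (N(l - k) - (m - 1)/p) / m ([residual_influence]).  Thus V_kl is
    r_kl ^ 2 and |r_kl| <= B.

    Conditionally on U this is a linear form in independent centered Poisson
    variables, with variance v_k = <V_k, lambda>.  Bernstein's inequality at
    level theta = 2 log p ([poisson_bernstein]) bounds it by
    sqrt (2 theta v_k) + B theta / 3, up to probability p ^ -2 on each side.
    The variance v_k is not observed, but <V_k, Y> estimates it: the same
    inequality applied to the coefficients - V_kl, which are nonpositive and
    hence need no linear correction, gives
    v_k - <V_k, Y> <= sqrt (2 theta B ^ 2 v_k).  Solving this quadratic
    inequality for sqrt v_k turns the bound into the weight d_k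
    ([data_driven_weight]).  A union bound over three deviations for each of
    the p coordinates costs 3 / p, so C = 4 gives the strict inequality.

    All the variables take values in nat.  Restricting to outcomes where
    every U_i and Y_l is below N turns each expectation into a finite sum, in
    which the Laplace transform of a Poisson variable becomes an exponential
    tilting of its weights ([poisson_chernoff]).  The bounds do not depend on
    N, and N tends to infinity only once, in [pr_le_disintegration], by
    continuity of the measure along an increasing union. *)

(** * A second-order bound on the exponential *)

(** The sign condition on c covers both positions of x relative to 0, so that
    the lemma can be iterated: f and then its derivative. *)
Lemma mvt_from0 (R : realType) (f df : R -> R) (x : R) :
  (forall z : R, is_derive z 1 f (df z)) ->
  exists2 c, 0 <= c * x & f x = f 0 + df c * x.
Proof.
move=> fd.
have fc a b : {within `[a, b], continuous f}.
  apply: continuous_subspaceT => z; apply: differentiable_continuous.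
  by apply/derivable1_diffP; have [] := fd z.
have [x0|x0|->] := ltgtP x 0; last by exists 0; rewrite ?mulr0 ?addr0.
- have [|c] := MVT x0 (fun z _ => fd z); first exact: fc.
  rewrite in_itv/= => /andP[_ c0] E; exists c; first by rewrite mulr_le0 ?ltW.
  by rewrite -[LHS](subKr (f 0)) E sub0r mulrN opprK.
- have [|c] := MVT x0 (fun z _ => fd z); first exact: fc.
  rewrite in_itv/= => /andP[c0 _] E; exists c; first by rewrite mulr_ge0 ?ltW.
  by rewrite -[LHS](subrK (f 0)) E subr0 addrC.
Qed.

(** For 0 <= x < 3 this is exp x - 1 - x <= x^2 / (2 (1 - x/3)), the source of
    the B theta / 3 term of Bernstein's inequality.  The difference h of the
    two sides vanishes at 0 to second order and its second derivative
    (1 - (1 - x) exp x) / 3 is nonnegative, because 1 - x <= exp (- x). *)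
Lemma expR_second_order (R : realType) (x : R) :
  (1 - x / 3) * (expR x - 1 - x) <= x ^+ 2 / 2.
Proof.
pose h (z : R) : R := z ^+ 2 / 2 - (1 - z / 3) * (expR z - 1 - z).
pose dh (z : R) : R := (2 + z + expR z * (z - 2)) / 3.
pose ddh (z : R) : R := (1 - expR z * (1 - z)) / 3.
have hd : forall z : R, is_derive z 1 h (dh z).
  move=> z; rewrite /h; apply: is_derive_eq; rewrite /dh /GRing.scale/=; by field.
have dhd : forall w : R, is_derive w 1 dh (ddh w).
  move=> w; rewrite {1}/dh; apply: is_derive_eq; rewrite /ddh /GRing.scale/=; by field.
have ddh0 z : 0 <= ddh z.
  have := expR_ge1Dx (- z) => le1.
  have : expR z * (1 - z) <= expR z * expR (- z) by rewrite ler_wpM2l ?expR_ge0.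
  by rewrite expRN mulfV ?expR_eq0// /ddh => ?; lra.
(* h x = h'(c) x = h''(e) c x with c x >= 0 *)
have [c cx hx] := mvt_from0 _ _ _ x hd.
have [e _ hc] := mvt_from0 _ _ _ c dhd.
rewrite -subr_ge0 -/(h x) hx hc.
have -> : h 0 = 0 by rewrite /h expR0; field.
have -> : dh 0 = 0 by rewrite /dh expR0; field.
by rewrite !add0r -mulrA mulr_ge0.
Qed.

(** * Bernstein's inequality for independent Poisson variables *)

(** Unlike [poisson_pmf], this is also the right mass function at mu = 0,
    where it is the indicator of n = 0 since 0 ^+ 0 = 1. *)
Definition poisson_weight {R : realType} (mu : R) (n : nat) : R :=
  mu ^+ n / n`!%:R * expR (- mu).

Lemma poisson_weight_ge0 {R : realType} (mu : R) n :
  0 <= mu -> 0 <= poisson_weight mu n.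
Proof.
by move=> mu0; rewrite mulr_ge0 ?expR_ge0// mulr_ge0 ?exprn_ge0 ?invr_ge0 ?ler0n.
Qed.

Lemma sum_poisson_weight_le1 {R : realType} (mu : R) N :
  0 <= mu -> \sum_(n < N) poisson_weight mu n <= 1.
Proof.
move=> mu0; rewrite -mulr_suml expRN ler_pdivrMr ?expR_gt0// mul1r.
rewrite -(big_mkord xpredT (fun n => mu ^+ n / n`!%:R)).
apply: (nondecreasing_cvgn_le _ (is_cvg_series_exp_coeff mu) N).
by apply: nondecreasing_series => n _ _; exact: exp_coeff_ge0.
Qed.

(** Exponential tilting of a Poisson law, divided by its Laplace transform,
    is a Poisson law with another mean. *)
Lemma poisson_tilting {R : realType} (mu t : R) n :
  poisson_weight mu n * expR (t * n%:R - mu * (expR t - 1)) =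
  poisson_weight (mu * expR t) n.
Proof.
rewrite /poisson_weight exprMn -expRM_natr -mulrA -expRD.
have -> : - mu + (t * n%:R - mu * (expR t - 1)) = t * n%:R - mu * expR t by ring.
by rewrite expRD; ring.
Qed.

(** The truncated grid {0, ..., N-1}^I carries total mass at most 1 under any
    product of Poisson weights.  On Q the original weights are at most
    exp (- a) times the tilted ones, which are again of this form. *)
Lemma poisson_chernoff {R : realType} {I : finType} N (mu f : I -> R) (a : R)
    (Q : pred {ffun I -> 'I_N}) :
  (forall l, 0 <= mu l) ->
  (forall y, Q y ->
     a <= \sum_l (f l * (y l)%:R - mu l * (expR (f l) - 1))) ->
  \sum_(y | Q y) \prod_l poisson_weight (mu l) (y l) <= expR (- a).
Proof.
move=> mu0 Qa.
have tilt y : Q y -> \prod_l poisson_weight (mu l) (y l) <=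
    expR (- a) * \prod_l poisson_weight (mu l * expR (f l)) (y l).
  move=> /Qa ay; under [X in _ <= _ * X]eq_bigr do rewrite -poisson_tilting.
  rewrite [X in _ <= _ * X]big_split/= mulrCA.
  apply: ler_peMr; first by apply: prodr_ge0 => l _; exact: poisson_weight_ge0.
  by rewrite -expR_sum -expRD -[leLHS]expR0 ler_expR addrC subr_ge0.
apply: (le_trans (ler_sum _ tilt)); rewrite -mulr_sumr ler_piMr ?expR_ge0//.
have w0 (y : {ffun I -> 'I_N}) :
    0 <= \prod_l poisson_weight (mu l * expR (f l)) (y l).
  by apply: prodr_ge0 => l _; rewrite poisson_weight_ge0// mulr_ge0 ?expR_ge0.
apply: (@le_trans _ _ (\sum_(y : {ffun I -> 'I_N})
    \prod_l poisson_weight (mu l * expR (f l)) (y l))).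
  by rewrite [leRHS](bigID Q)/= lerDl sumr_ge0.
rewrite -(bigA_distr_bigA (fun l (n : 'I_N) => poisson_weight (mu l * expR (f l)) n)).
apply: Num.Theory.prodr_ile1 => l _.
rewrite sum_poisson_weight_le1 ?mulr_ge0 ?expR_ge0// andbT.
by rewrite sumr_ge0// => n _; rewrite poisson_weight_ge0// mulr_ge0 ?expR_ge0.
Qed.

(** Chernoff's bound with coefficients t * r l, for the t that is optimal
    after the cumulant has been bounded by [expR_second_order].  The
    bound r l <= b is one-sided so that nonpositive coefficients can take
    b = 0, which removes the linear term. *)
Lemma poisson_bernstein {R : realType} {I : finType} N (mu r : I -> R)
    (b theta : R) (Q : pred {ffun I -> 'I_N}) :
  (forall l, 0 <= mu l) -> 0 <= b -> (forall l, r l <= b) -> 0 <= theta ->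
  (forall y, Q y ->
     Num.sqrt (2 * theta * \sum_l r l ^+ 2 * mu l) + b * theta / 3 <
     \sum_l r l * ((y l)%:R - mu l)) ->
  \sum_(y | Q y) \prod_l poisson_weight (mu l) (y l) <= expR (- theta).
Proof.
move=> mu0 b0 rb th0; set v := \sum_l _ => Qdev.
have v_ge0 : 0 <= v by apply: sumr_ge0 => l _; rewrite mulr_ge0 ?sqr_ge0.
(* With zero variance the optimal t is infinite; but then a positive deviation
   needs some y l > 0 with mu l = 0, so that the weight itself is 0. *)
have [v0|v_neq0] := eqVneq v 0.
  rewrite big1 ?expR_ge0// => y /Qdev.
  rewrite v0 mulr0 sqrtr0 add0r => dev.
  have rmu l : r l * mu l = 0.
    have := v0; rewrite /v => /eqP; rewrite psumr_eq0; last first.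
      by move=> k _; rewrite mulr_ge0 ?sqr_ge0.
    move=> /allP/(_ l (mem_index_enum _))/=.
    by rewrite mulf_eq0 sqrf_eq0 -mulf_eq0 => /eqP.
  have [l rl] : exists l, r l * (y l)%:R != 0.
    apply/existsP; apply: contraTT dev => /existsPn ry; rewrite -leNgt big1.
      by rewrite divr_ge0 ?mulr_ge0.
    move=> l _; rewrite mulrBr rmu subr0.
    by apply/eqP; move: (ry l); rewrite negbK.
  rewrite (bigD1 l)//= /poisson_weight.
  move: rl (rmu l); rewrite mulf_eq0 negb_or => /andP[rl yl] /eqP.
  rewrite mulf_eq0 (negbTE rl)/= => /eqP ->.
  by rewrite expr0n; move: yl; rewrite pnatr_eq0 => /negbTE ->; rewrite !mul0r.
have v_gt0 : 0 < v by rewrite lt_neqAle eq_sym v_neq0.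
(* t = q / (1 + b q / 3) makes t times the threshold equal to
   theta + theta / D, while the cumulant is at most theta / D. *)
pose q := Num.sqrt (2 * theta / v).
have q0 : 0 <= q by exact: sqrtr_ge0.
have q2 : q ^+ 2 * v = 2 * theta.
  by rewrite sqr_sqrtr ?divfK// divr_ge0 ?mulr_ge0// ?ltW.
have qv : Num.sqrt (2 * theta * v) = q * v.
  rewrite -q2 -mulrA -expr2 -exprMn sqrtr_sqr ger0_norm// mulr_ge0//.
pose D := 1 + b / 3 * q.
have D0 : 0 < D by rewrite /D ltr_pwDl// mulr_ge0 ?divr_ge0.
pose t := q / D.
have t0 : 0 <= t by rewrite divr_ge0// ltW.
have tb : 1 - t * b / 3 = D^-1.
  by rewrite /t /D; field; rewrite lt0r_neq0// ltr_pwDl// mulr_ge0.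
apply: (poisson_chernoff _ mu (fun l => t * r l)) => // y /Qdev.
rewrite qv => dev.
have cost l : mu l * (expR (t * r l) - 1 - t * r l) <=
    D * (t ^+ 2 / 2) * (r l ^+ 2 * mu l).
  have e0 : 0 <= expR (t * r l) - 1 - t * r l.
    by have := expR_ge1Dx (t * r l) => ?; lra.
  have : D^-1 * (expR (t * r l) - 1 - t * r l) <= (t * r l) ^+ 2 / 2.
    apply: le_trans (expR_second_order _ _).
    apply: ler_wpM2r => //; rewrite -tb lerD2l lerN2 ler_wpM2r ?invr_ge0//.
    exact: ler_wpM2l.
  rewrite mulrC ler_pdivrMr// => h.
  have -> : D * (t ^+ 2 / 2) * (r l ^+ 2 * mu l) =
    mu l * ((t * r l) ^+ 2 / 2 * D) by ring.
  by rewrite ler_wpM2l.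
have -> : \sum_l (t * r l * (y l)%:R - mu l * (expR (t * r l) - 1)) =
    t * \sum_l r l * ((y l)%:R - mu l) -
    \sum_l mu l * (expR (t * r l) - 1 - t * r l).
  by rewrite mulr_sumr -sumrB; apply: eq_bigr => l _; ring.
apply: (@le_trans _ _ (t * (q * v + b * theta / 3) - D * (t ^+ 2 / 2) * v)).
  have -> : t * (q * v + b * theta / 3) - D * (t ^+ 2 / 2) * v =
      (2 * (q ^+ 2 * v) + 2 * (b / 3 * q) * theta - (q ^+ 2 * v)) / (2 * D).
    by rewrite /t; field; rewrite lt0r_neq0.
  rewrite q2 ler_pdivlMr ?mulr_gt0// /D; lra.
by rewrite lerB ?ler_wpM2l ?(ltW dev)// /v mulr_sumr; exact: ler_sum.
Qed.

Lemma poisson_probE {R : realType} (mu : R) (n : nat) : 0 <= mu ->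
  fine (poisson_prob mu 0%N [set n]) = poisson_weight mu n.
Proof.
rewrite /poisson_prob le_eqVlt => /orP[/eqP <-|mu0]; last first.
  rewrite mu0 esum_set1 ?lee_fin ?poisson_pmf_ge0//= /poisson_pmf mu0//.
rewrite ltxx diracE /poisson_weight oppr0 expR0 mulr1 expr0n.
have [->|n0] := eqVneq n 0%N; first by rewrite mem_set//= fact0 divr1.
by rewrite memNset//= ?mul0r// => n0'; rewrite n0' eqxx in n0.
Qed.

(** * The residual as a linear form in the noise *)

Lemma Ncount_eqmod p m (u : 'I_m -> nat) (a b : int) :
  (a = b %[mod p%:Z])%Z -> Ncount p u a = Ncount p u b.
Proof. by move=> ab; rewrite /Ncount; apply: eq_card => i; rewrite !inE ab. Qed.

(** Each u i is congruent to l - k for exactly one l, namely the remainder of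
    u i + k. *)
Lemma sum_Ncount p m (u : 'I_m -> nat) (k : int) : (0 < p)%N ->
  (\sum_(l < p) Ncount p u (l%:Z - k) = m)%N.
Proof.
move=> p0; rewrite -[RHS]card_ord.
have pN0 : p%:Z != 0 :> int by rewrite -lt0n.
transitivity (\sum_(l < p) \sum_(i < m)
   ((u i)%:Z == l%:Z - k %[mod p%:Z])%Z)%N.
  by apply: eq_bigr => l _; rewrite /Ncount -sum1_card big_mkcond.
rewrite exchange_big/= -sum1_card; apply: eq_bigr => i _.
have [n nE] : exists n : nat, (((u i)%:Z + k) %% p%:Z)%Z = n.
  by exists `|(((u i)%:Z + k) %% p%:Z)%Z|%N; rewrite gez0_abs ?modz_ge0.
have np : (n < p)%N by rewrite -ltz_nat -nE ltz_pmod.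
rewrite (bigD1 (Ordinal np))//= big1 => [|l lnp]; rewrite ?addn0.
  by rewrite -nE eqz_mod_dvd opprB addrA -eqz_mod_dvd modz_mod eqxx.
apply/eqP; rewrite eqb0; apply: contra lnp => /eqP ul; apply/eqP/val_inj => /=.
have : ((u i)%:Z + k = l%:Z %[mod p%:Z])%Z.
  by move/eqP: ul; rewrite !eqz_mod_dvd opprB addrA -eqz_mod_dvd => /eqP.
by rewrite nE modz_small ?ltz_nat ?ltn_ord// => -[].
Qed.

(** The coefficient of the noise Y_l - (A x)_l in the k-th coordinate of the
    residual; its square is V_kl. *)
Definition influence {R : realType} {p m} (u : 'I_m -> nat) (k l : 'I_p) : R :=
  ((Ncount p u (l%:Z - k%:Z))%:R - (m%:R - 1) / p%:R) / m%:R.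

(** B_max runs over residues, so l - k is first reduced modulo p. *)
Lemma influence_le_B_max {R : realType} {p m} (u : 'I_m -> nat) (k l : 'I_p) :
  `|influence u k l| <= B_max R p u.
Proof.
have p0 : (0 < p)%N := leq_ltn_trans (leq0n k) (ltn_ord k).
have pN0 : p%:Z != 0 :> int by rewrite -lt0n.
pose a : int := ((l%:Z - k%:Z) %% p%:Z)%Z.
have [n nE] : exists n : nat, a = n by exists `|a|%N; rewrite gez0_abs ?modz_ge0.
have np : (n < p)%N by rewrite -ltz_nat -nE ltz_pmod.
rewrite /influence (Ncount_eqmod _ _ _ _ n); last by rewrite -nE /a modz_mod.
rewrite normrM mulrC [`|m%:R^-1|]ger0_norm ?invr_ge0//.
exact: (le_bigmax 0 (fun v : 'I_p => m%:R^-1 *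
  `|(Ncount p u v%:Z)%:R - (m%:R - 1) / p%:R|) (Ordinal np)).
Qed.

(** Let s = sqrt m, c the centering, z = y - A x and Z its sum.  As the columns
    of A sum to m, y_tilde - At x = z / s - (c / m) Z, and the
    transpose of At maps this vector to A^T z / m - (c (s + 1) / m) Z, where
    c (s + 1) = (m - 1) / p because c p = s - 1. *)
Lemma residual_influence {R : realType} {p m} (u : 'I_m -> nat)
    (x y : 'cV[R]_p) (k : 'I_p) :
  (0 < m)%N -> (forall l, 0 <= y l 0) ->
  ((conv_mx_tilde R p u)^T *m (y_tilde m y - conv_mx_tilde R p u *m x)) k 0 =
  \sum_l influence u k l * (y l 0 - (conv_mx R p u *m x) l 0).
Proof.
move=> m_gt0 y0.
have p_gt0 : (0 < p)%N := leq_ltn_trans (leq0n k) (ltn_ord k).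
have pN0 : p%:R != 0 :> R by rewrite pnatr_eq0 -lt0n.
pose s : R := Num.sqrt m%:R.
have s2 : s ^+ 2 = m%:R by rewrite sqr_sqrtr.
have sN0 : s != 0 by rewrite sqrtr_eq0 -ltNge ltr0n.
pose c : R := centering R p m.
have cp : c * p%:R = s - 1 by rewrite /c /centering divfK.
pose N l j : R := (Ncount p u ((l : 'I_p)%:Z - (j : 'I_p)%:Z))%:R.
have sumN j : \sum_l N l j = s ^+ 2 by rewrite -natr_sum sum_Ncount.
have AtE l j : conv_mx_tilde R p u l j = s^-1 * N l j - c.
  by rewrite !mxE big_ord1 !mxE !mulr1.
pose lam l : R := (conv_mx R p u *m x) l 0.
have lamE l : lam l = \sum_j N l j * x j 0.
  by rewrite /lam mxE; apply: eq_bigr => j _; rewrite mxE.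
pose X := \sum_j x j 0.
have AtxE l : (conv_mx_tilde R p u *m x) l 0 = s^-1 * lam l - c * X.
  rewrite mxE lamE !mulr_sumr -sumrB; apply: eq_bigr => j _.
  by rewrite AtE mulrBl mulrA.
have sum_lam : \sum_l lam l = s ^+ 2 * X.
  under eq_bigr do rewrite lamE.
  rewrite exchange_big/= mulr_sumr; apply: eq_bigr => j _.
  by rewrite -mulr_suml sumN.
pose z l := y l 0 - lam l.
pose Z := \sum_l z l.
have ZE : Z = \sum_l y l 0 - s ^+ 2 * X by rewrite /Z sumrB sum_lam.
have resE l : (y_tilde m y - conv_mx_tilde R p u *m x) l 0 =
    s^-1 * z l - c / s ^+ 2 * Z.
  rewrite mxE [X in _ + X]mxE AtxE mxE -/s -/c /ybar -s2 ZE /z.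
  have -> : \sum_(j < p) `|y j 0| = \sum_l y l 0.
    by apply: eq_bigr => j _; rewrite ger0_norm.
  by field.
rewrite mxE.
under eq_bigr => l _ do rewrite mxE resE AtE.
have -> e : \sum_l (s^-1 * N l k - c) * (s^-1 * z l - e) =
    s^-1 ^+ 2 * \sum_l N l k * z l - s^-1 * e * \sum_l N l k
    - c * s^-1 * Z + p%:R * (c * e).
  have -> : p%:R * (c * e) = \sum_(l < p) c * e.
    by rewrite sumr_const card_ord mulr_natl.
  rewrite /Z !mulr_sumr -!sumrB -big_split/=; apply: eq_bigr => l _.
  by ring.
rewrite sumN.
have -> : \sum_l influence u k l * z l =
    s^-1 ^+ 2 * \sum_l N l k * z l - (s ^+ 2 - 1) / p%:R / s ^+ 2 * Z.
  rewrite /Z !mulr_sumr -!sumrB; apply: eq_bigr => l _.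
  by rewrite /influence -/(N l k) -s2; field; rewrite sN0.
have -> : c = (s - 1) / p%:R by rewrite -cp mulfK.
by field; rewrite sN0.
Qed.

(** With a = sqrt v and c = sqrt (B^2 L), the second and third bounds give
    a^2 - VY <= 2 c a, so (a - c)^2 <= VY + c^2 and
    a <= sqrt (VY + B^2 L) + c; the factor 5/3 of the weight leaves room to
    spare. *)
Lemma data_driven_weight {R : realType} (S v w VY B L : R) :
  0 <= v -> 0 <= L -> 0 <= B -> 0 <= VY ->
  S <= Num.sqrt (2 * (2 * L) * v) + B * (2 * L) / 3 ->
  v - VY <= Num.sqrt (2 * (2 * L) * w) -> w <= B ^+ 2 * v ->
  S <= Num.sqrt (4 * L) * (Num.sqrt (VY + 5 * B ^+ 2 * L / 3) +
         Num.sqrt (B ^+ 2 * L)) + 2 * B * L / 3.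
Proof.
move=> v0 L0 B0 VY0 Sle vVY wB.
have -> : 2 * B * L / 3 = B * (2 * L) / 3 by ring.
apply: (le_trans Sle); rewrite lerD2r.
have -> : 2 * (2 * L) * v = 4 * L * v by ring.
rewrite sqrtrM ?mulr_ge0// ler_wpM2l ?sqrtr_ge0// -lerBlDr.
set a := Num.sqrt v; set c := Num.sqrt (B ^+ 2 * L).
have a2 : a ^+ 2 = v by rewrite sqr_sqrtr.
have c2 : c ^+ 2 = B ^+ 2 * L by rewrite sqr_sqrtr// mulr_ge0 ?sqr_ge0.
have BL0 : 0 <= B ^+ 2 * L by rewrite mulr_ge0 ?sqr_ge0.
have ac : Num.sqrt (2 * (2 * L) * w) <= 2 * c * a.
  have -> : 2 * c * a = Num.sqrt ((2 * c * a) ^+ 2).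
    by rewrite sqrtr_sqr ger0_norm// !mulr_ge0 ?sqrtr_ge0.
  rewrite ler_wsqrtr// !exprMn a2 c2.
  have -> : 2 ^+ 2 * (B ^+ 2 * L) * v = 2 * (2 * L) * (B ^+ 2 * v) by ring.
  by rewrite ler_wpM2l// !mulr_ge0.
apply: (le_trans (ler_norm _)); rewrite -sqrtr_sqr ler_wsqrtr//.
rewrite sqrrB a2 c2 mulr2n; move: ac vVY BL0; lra.
Qed.

(** * The failure probability for given locations *)

Lemma sum_union_bound {R : numDomainType} {I J : finType} (w : I -> R)
    (Q : pred I) (D : J -> pred I) :
  (forall i, 0 <= w i) -> (forall i, Q i -> exists j, D j i) ->
  \sum_(i | Q i) w i <= \sum_j \sum_(i | D j i) w i.
Proof.
move=> w0 QD; rewrite big_mkcond/=.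
under [leRHS]eq_bigr do rewrite big_mkcond.
rewrite [leRHS]exchange_big/=; apply: ler_sum => i _.
case: ifPn => [/QD[j Dji]|_]; last by apply: sumr_ge0 => j _; case: ifP.
by rewrite (bigD1 j)//= Dji lerDl; apply: sumr_ge0 => k _; case: ifP.
Qed.

(** Stated with the linear form instead of the residual, since that is what
    the Poisson deviation bounds control. *)
Definition weight_violated {R : realType} {p m} (x : 'cV[R]_p)
    (u : 'I_m -> nat) (y : 'I_p -> nat) : bool :=
  ~~ [forall k, `|\sum_l influence u k l * ((y l)%:R - (conv_mx R p u *m x) l 0)|
                <= weight u (\col_l (y l)%:R) k].

(** The 3 p deviations are indexed by a coordinate and an option: Some true and
    Some false for the two signs of the linear form, None for the
    underestimation of the variance.  Outside all of them
    [data_driven_weight] applies at every coordinate, and each has weight at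
    most exp (- 2 log p). *)
Lemma weight_violation_sum {R : realType} {p m} (x : 'cV[R]_p)
    (u : 'I_m -> nat) N :
  (0 < p)%N -> (forall k, 0 <= x k 0) ->
  \sum_(y : {ffun 'I_p -> 'I_N} | weight_violated x u (fun l => y l))
    \prod_l poisson_weight ((conv_mx R p u *m x) l 0) (y l) <= 3 / p%:R.
Proof.
move=> p0 x0; set lam := fun l => (conv_mx R p u *m x) l 0.
have lam0 l : 0 <= lam l.
  by rewrite /lam mxE sumr_ge0// => j _; rewrite mulr_ge0// mxE.
pose B := B_max R p u; pose L : R := ln p%:R.
have pR0 : 0 < p%:R :> R by rewrite ltr0n.
have L0 : 0 <= L by rewrite ln_ge0// ler1n.
have infB (k l : 'I_p) := influence_le_B_max (R := R) u k l.
have B0 : 0 <= B by apply: le_trans (infB (Ordinal p0) (Ordinal p0)).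
pose r (c : 'I_p * option bool) (l : 'I_p) : R :=
  match c.2 with
  | None => - influence u c.1 l ^+ 2
  | Some true => influence u c.1 l
  | Some false => - influence u c.1 l
  end.
pose b (c : 'I_p * option bool) : R := if c.2 is None then 0 else B.
pose D c (y : {ffun 'I_p -> 'I_N}) :=
  Num.sqrt (2 * (2 * L) * \sum_l r c l ^+ 2 * lam l) + b c * (2 * L) / 3 <
  \sum_l r c l * ((y l)%:R - lam l).
have w0 (y : {ffun 'I_p -> 'I_N}) : 0 <= \prod_l poisson_weight (lam l) (y l).
  by apply: prodr_ge0 => l _; exact: poisson_weight_ge0.
have cover (y : {ffun 'I_p -> 'I_N}) :
    weight_violated x u (fun l => y l) -> exists c, D c y.
  move=> viol; apply/existsP; apply: contraT => /existsPn noD.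
  case/negP: viol; apply/forallP => k.
  have [dev_pos dev_neg dev_V] :
    [/\ \sum_l influence u k l * ((y l)%:R - lam l) <=
          Num.sqrt (2 * (2 * L) * \sum_l influence u k l ^+ 2 * lam l)
          + B * (2 * L) / 3,
        - \sum_l influence u k l * ((y l)%:R - lam l) <=
          Num.sqrt (2 * (2 * L) * \sum_l influence u k l ^+ 2 * lam l)
          + B * (2 * L) / 3 &
        - \sum_l influence u k l ^+ 2 * ((y l)%:R - lam l) <=
          Num.sqrt (2 * (2 * L) * \sum_l (influence u k l ^+ 2) ^+ 2 * lam l)].
    have negr (f g : 'I_p -> R) : \sum_l - f l * g l = - \sum_l f l * g l.
      by rewrite -sumrN; apply: eq_bigr => l _; rewrite mulNr.
    have sqN (f : 'I_p -> R) :
        \sum_l (- f l) ^+ 2 * lam l = \sum_l f l ^+ 2 * lam l.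
      by apply: eq_bigr => l _; rewrite sqrrN.
    split.
    - by have := noD (k, Some true); rewrite /D -leNgt.
    - by have := noD (k, Some false); rewrite /D -leNgt /r /b/= negr sqN.
    - have := noD (k, None).
      by rewrite /D -leNgt /r /b/= negr sqN mul0r mul0r addr0.
  pose yv : 'cV[R]_p := \col_l (y l)%:R.
  have V_dotE : V_dot u k yv =
      \sum_l influence u k l ^+ 2 * (y l)%:R.
    by rewrite /V_dot; apply: eq_bigr => l _; rewrite !mxE.
  have bound S : S <= Num.sqrt (2 * (2 * L) *
      \sum_l influence u k l ^+ 2 * lam l) + B * (2 * L) / 3 ->
      S <= weight u yv k.
    move=> Sle; apply: (data_driven_weight _ _
        (\sum_l (influence u k l ^+ 2) ^+ 2 * lam l) _ _ _ _ _ _ _ Sle) => //.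
    - by apply: sumr_ge0 => l _; rewrite mulr_ge0 ?sqr_ge0.
    - by rewrite V_dotE; apply: sumr_ge0 => l _; rewrite mulr_ge0 ?sqr_ge0.
    - rewrite V_dotE -sumrB; apply: le_trans dev_V; rewrite -sumrN.
      by apply: ler_sum => l _; rewrite -mulrBr -mulrN opprB.
    - rewrite mulr_sumr; apply: ler_sum => l _.
      rewrite mulrA ler_wpM2r// expr2 ler_wpM2r ?sqr_ge0//.
      by rewrite -real_normK ?num_real// lerXn2r ?nnegrE.
  by rewrite ler_norml -[X in X && _]lerNl !bound.
apply: (le_trans (sum_union_bound _ _ _ w0 cover)).
apply: (@le_trans _ _ (\sum_(c : 'I_p * option bool) expR (- (2 * L)))).
  apply: ler_sum => c _.
  apply: (poisson_bernstein _ _ (r c) (b c)) => //; rewrite ?mulr_ge0//.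
    by rewrite /b; case: c.2.
  move=> l; rewrite /r /b; case: c.2 => [[]|].
  - exact: le_trans (ler_norm _) (infB _ _).
  - by rewrite (le_trans (ler_norm _))// normrN infB.
  - by rewrite oppr_le0 sqr_ge0.
rewrite sumr_const card_prod card_ord card_option card_bool.
have -> : expR (- (2 * L)) = p%:R^-1 ^+ 2.
  by rewrite expRN expRM_natl lnK ?posrE// exprVn.
rewrite -[leLHS]mulr_natl natrM; rewrite le_eqVlt; apply/orP; left; apply/eqP.
by field; exact: lt0r_neq0.
Qed.

(** * From finite sums to the probability space *)

Lemma measure_bigcup_pred {d} {T : measurableType d} {R : realType}
    (mu : measure T R) {I : finType} (Q : pred I) (F : I -> set T) :
  (forall i, measurable (F i)) -> trivIset setT F ->
  mu (\bigcup_(i in [set` Q]) F i) = (\sum_(i | Q i) mu (F i))%E.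
Proof.
move=> mF tF; rewrite measure_fin_bigcup//; last exact: sub_trivIset tF.
rewrite -(@bigfs _ _ _ _ (index_enum I)) ?index_enum_uniq// => i _.
by rewrite mem_index_enum.
Qed.

Definition fiber {T I : Type} (X : I -> T -> nat) (v : I -> nat) : set T :=
  [set w | forall i, X i w = v i].

Section fibers.
Context {d} {T : measurableType d} {R : realType} (P : probability T R).

Lemma probability_pr (A : set T) : measurable A -> P A = (pr P A)%:E.
Proof. by move=> mA; rewrite /pr fineK// fin_num_measure. Qed.

Lemma pr_ge0 (A : set T) : 0 <= pr P A.
Proof. exact/fine_ge0/measure_ge0. Qed.

Lemma fiber_bigcap {I : finType} (X : I -> T -> nat) v :
  fiber X v = \bigcap_(i in setT) (X i @^-1` [set v i]).
Proof. by apply/seteqP; split => w /= Xv i; [move=> _|]; exact: Xv. Qed.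

Lemma measurable_fiber {I : finType} (X : I -> {RV P >-> nat}) v :
  measurable (fiber X v).
Proof.
by rewrite fiber_bigcap; apply: fin_bigcap_measurable => // i _; exact: measurable_funPTI.
Qed.

Lemma trivIset_fiber {I : finType} N (X : I -> T -> nat) :
  trivIset setT (fun v : {ffun I -> 'I_N} => fiber X (fun i => v i)).
Proof.
move=> v v' _ _ [w [Xv Xv']]; apply/ffunP => i; apply: val_inj => /=.
by rewrite -(Xv i) -(Xv' i).
Qed.

Lemma sum_pr_fiber_le1 {I : finType} N (X : I -> {RV P >-> nat}) :
  \sum_(v : {ffun I -> 'I_N}) pr P (fiber X (fun i => v i)) <= 1.
Proof.
rewrite -lee_fin -sumEFin.
rewrite (eq_bigr (fun v : {ffun I -> 'I_N} => P (fiber X (fun i => v i)))).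
  2: by move=> v _; rewrite probability_pr//; exact: measurable_fiber.
rewrite -(measure_bigcup_pred _ xpredT)//; last exact: trivIset_fiber.
  by apply: probability_le1; apply: fin_bigcup_measurable => // v _; exact: measurable_fiber.
by move=> v; exact: measurable_fiber.
Qed.

(** Total probability over the outcomes u of X, where K u is the conditional
    mass function of Z.  Cutting both X and Z at N leaves finitely many
    outcomes; letting N grow gives measurability as well as the bound. *)
Lemma pr_le_disintegration {I J : finType} (X : I -> {RV P >-> nat})
    (Z : J -> {RV P >-> nat}) (K : (I -> nat) -> (J -> nat) -> R)
    (bad : (I -> nat) -> (J -> nat) -> bool) (eps : R) :
  0 <= eps ->
  (forall u y, 0 < pr P (fiber X u) ->
     pr P (fiber Z y `&` fiber X u) = pr P (fiber X u) * K u y) ->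
  (forall u N, \sum_(y : {ffun J -> 'I_N} | bad u (fun l => y l))
     K u (fun l => y l) <= eps) ->
  measurable [set w | bad (fun i => X i w) (fun l => Z l w)] /\
  (P [set w | bad (fun i => X i w) (fun l => Z l w)] <= eps%:E)%E.
Proof.
move=> eps0 joint tail.
pose cell N (c : {ffun I -> 'I_N} * {ffun J -> 'I_N}) : set T :=
  fiber Z (fun l => c.2 l) `&` fiber X (fun i => c.1 i).
have mcell N c : measurable (cell N c).
  by apply: measurableI; exact: measurable_fiber.
pose F N := \bigcup_(c in [set` [pred c : {ffun I -> 'I_N} * {ffun J -> 'I_N} |
  bad (fun i => c.1 i) (fun l => c.2 l)]]) cell N c.
have FE N : F N = [set w | bad (fun i => X i w) (fun l => Z l w) /\
    (forall i, (X i w < N)%N) /\ forall l, (Z l w < N)%N].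
  apply/seteqP; split => w /=.
    move=> [[u y]]/= ub [/= Zy Xu]; split; last by split=> i; rewrite ?Xu ?Zy.
    move: ub; rewrite inE/=; congr (is_true (bad _ _)).
      by apply/funext => i; rewrite Xu.
    by apply/funext => l; rewrite Zy.
  move=> [wb [XN ZN]].
  exists ([ffun i => Ordinal (XN i)], [ffun l => Ordinal (ZN l)]).
    rewrite /= inE/=; move: wb; congr (is_true (bad _ _)).
      by apply/funext => i; rewrite ffunE.
    by apply/funext => l; rewrite ffunE.
  by split => i /=; rewrite ffunE.
have mF N : measurable (F N).
  by apply: fin_bigcup_measurable => // c _; exact: mcell.
have cupF : [set w | bad (fun i => X i w) (fun l => Z l w)] = \bigcup_N F N.
  apply/seteqP; split => [w /= wb|w [N _]]; last by rewrite FE => -[].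
  exists (maxn (\max_i X i w) (\max_l Z l w)).+1 => //; rewrite FE; split => //.
  split => i; rewrite ltnS leq_max.
    by rewrite (leq_bigmax (F := fun i => X i w)).
  by rewrite (leq_bigmax (F := fun l => Z l w)) orbT.
have mcupF : measurable (\bigcup_N F N) by exact: bigcupT_measurable.
rewrite cupF; split=> //.
have PF N : (P (F N) <= eps%:E)%E.
  rewrite measure_bigcup_pred//; last first.
    move=> [u y] [u' y'] _ _ [w [[/= Zy Xu] [/= Zy' Xu']]].
    by congr pair; [apply: (trivIset_fiber N X) => //|
      apply: (trivIset_fiber N Z) => //]; exists w.
  rewrite (eq_bigr (fun c => (pr P (cell N c))%:E)); last first.
    by move=> c _; exact/probability_pr/mcell.
  rewrite sumEFin lee_fin.
  rewrite -(pair_big_dep xpredT (fun u y : {ffun _ -> 'I_N} =>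
      bad (fun i => u i) (fun l => y l)) (fun u y => pr P (cell N (u, y))))/=.
  apply: (@le_trans _ _ (\sum_(u : {ffun I -> 'I_N}) pr P (fiber X (fun i => u i)) * eps)).
    apply: ler_sum => u _.
    have := pr_ge0 (fiber X (fun i => u i)); rewrite le_eqVlt => /orP[/eqP X0|X0].
      rewrite -X0 mul0r big1// => y _; apply/eqP; rewrite eq_le pr_ge0 andbT.
      rewrite X0 -lee_fin -!probability_pr//; last exact: measurable_fiber.
      apply: le_measure; rewrite ?inE; [exact: mcell|exact: measurable_fiber|].
      exact: subIsetr.
    under eq_bigr => y _ do rewrite /cell/= joint//.
    by rewrite -mulr_sumr ler_wpM2l ?pr_ge0//; exact: tail.
  by rewrite -mulr_suml ler_piMl// sum_pr_fiber_le1.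
have ndF : nondecreasing_seq F.
  move=> N N' NN'; apply/subsetPset => w; rewrite !FE => -[wb [XN ZN]].
  by split=> //; split=> i; rewrite (leq_trans _ NN').
have cvgF := nondecreasing_cvg_mu (mu := P) mF mcupF ndF.
rewrite -(cvg_lim _ cvgF)//; apply: lime_le.
  by apply/cvg_ex; eexists; exact: cvgF.
by apply: nearW => N; exact: PF.
Qed.

End fibers.

(** The product rule for the full index set and singletons yields the joint
    mass function of Y on an outcome of U. *)
Lemma cond_poisson_joint {d} {T : measurableType d} {R : realType}
    {P : probability T R} {p m} (U : 'I_m -> {RV P >-> nat})
    (Y : 'I_p -> {RV P >-> nat}) (x : 'cV[R]_p) (u : 'I_m -> nat) y :
  (forall k, 0 <= x k 0) -> cond_poisson U Y x -> 0 < pr P (fiber U u) ->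
  pr P (fiber Y y `&` fiber U u) = pr P (fiber U u) *
    \prod_l poisson_weight ((conv_mx R p u *m x) l 0) (y l).
Proof.
move=> x0 YU Eu; have [indep law] := YU u Eu.
have := indep [set: 'I_p]%SET (fun l => [set y l]) (fun _ => I).
have -> : \bigcap_(l in [set` [set: 'I_p]%SET]) (Y l @^-1` [set y l]) = fiber Y y.
  rewrite fiber_bigcap; apply/seteqP; split => w Yw l _; apply: Yw => //=.
  by rewrite inE.
rewrite /cond_pr -/(fiber U u) => /(canRL (divfK (lt0r_neq0 Eu))) ->.
rewrite mulrC; congr (_ * _); apply: eq_big => [l|l _]; first by rewrite inE.
rewrite -poisson_probE -?law// mxE sumr_ge0// => j _.
by rewrite mulr_ge0// mxE.
Qed.

Theorem proposition13 (R : realType) :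
  exists C : R, 0 < C /\
  forall (p m s : nat) (x : 'cV[R]_p)
    (d : measure_display) (T : measurableType d) (P : probability T R)
    (U : 'I_m -> {RV P >-> nat}) (Y : 'I_p -> {RV P >-> nat}),
  (0 < p)%N -> (0 < m)%N ->
  (1 <= s < minn m p)%N ->
  (forall k : 'I_p, 0 <= x k 0) ->
  sparse s x ->
  iid_uniform p U ->
  cond_poisson U Y x ->
  ((1 - C / p%:R)%:E <
   P [set w : T |
        (let u := locations U w in
         let y := observations Y w in
         let At := conv_mx_tilde R p u in
         forall k : 'I_p,
           `|(At^T *m (y_tilde m y - At *m x)) k 0| <= weight u y k)%R])%E.
Proof.
exists 4; split=> // p m s x d T P U Y p0 m0 _ x0 _ _ YU.
have [mbad Pbad] := pr_le_disintegration P U Y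
  (fun u y => \prod_l poisson_weight ((conv_mx R p u *m x) l 0) (y l))
  (weight_violated x) (3 / p%:R) (divr_ge0 (ler0n _ _) (ler0n _ _))
  (fun u y => cond_poisson_joint U Y x u y x0 YU)
  (fun u N => weight_violation_sum x u N p0 x0).
set good := (X in P X).
have -> : good = ~` [set w | weight_violated x (fun i => U i w) (fun l => Y l w)].
  have obs0 w l : 0 <= observations Y w l 0 :> R by rewrite mxE ler0n.
  have residualE w k := residual_influence (locations U w) x (observations Y w)
    k m0 (obs0 w).
  have devE w k : \sum_l influence (locations U w) k l *
        (observations Y w l 0 - (conv_mx R p (locations U w) *m x) l 0) =
      \sum_l influence (locations U w) k l *
        ((Y l w)%:R - (conv_mx R p (locations U w) *m x) l 0).
    by apply: eq_bigr => l _; rewrite [observations _ _ _ _]mxE.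
  apply/seteqP; split => w; rewrite /good /weight_violated /=.
    move=> w_good; apply/negP; rewrite negbK; apply/forallP => k.
    by have := w_good k; rewrite residualE devE.
  by move=> /negP; rewrite negbK => /forallP w_good k; rewrite residualE devE.
rewrite probability_setC//.
apply: (@lt_le_trans _ _ (1 - 3 / p%:R)%:E).
  by rewrite lte_fin ltrD2l ltrN2 ltr_pM2r ?invr_gt0 ?ltr0n// ltr_nat.
by rewrite EFinB leeB.
Qed.
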